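(* Let $D$ be a non-negative linear combination of pure diagrams of codimension $p$. Then there is a diagram $E$ which is a non-negative linear combination of extremely compressed diagrams of codimension $p$ such that $D$ is obtained from $E$ by a sequence of consecutive cancellations and, furthermore, $E_{0,j}=D_{0,j}$ and $E_{p,j}=D_{p,j}$ for all integers $j$.
   Context: A diagram of codimension $p$ is a matrix $D=(D_{i,j})_{i,j\in\mathbb{Z}}$ of rational numbers with finitely many nonzero entries, with $D_{i,j}=0$ unless $0\le i\le p$, such that $\sum_{i,j}(-1)^iD_{i,j}t^j$ is divisible by $(1-t)^p$ in $\mathbb{Q}[t,t^{-1}]$. For a strictly increasing sequence of integers $d=(d_0,\dots,d_p)$, $\pi(d)$ denotes the unique diagram of codimension $p$ with $\pi(d)_{i,j}=0$ whenever $j\ne d_i$ and $\pi(d)_{0,d_0}=1$; it is the pure diagram of type $d$. A non-negative linear combination of pure diagrams is a finite sum $\sum_d a_d\pi(d)$ with $a_d\in\mathbb{Q}_{\ge0}$. An extremely compressed diagram of codimension $p$ is a pure diagram of type $(d_0,j+1,j+2,\dots,j+p-1,c+p)$ for some integers $d_0\le j\le c$. (In codimension $p=0,1,2$ every pure diagram is extremely compressed; for $p=0$ this is taken as the convention.) $C^{k,l}$ is the diagram with entry $1$ in positions $(k,l)$ and $(k+1,l)$ and $0$ elsewhere. A consecutive cancellation of a diagram $D$ is a diagram $D-bC^{k,l}$ with $b\in\mathbb{Q}_{\ge0}$ having no negative entries; that $D$ is obtained from $E$ by a sequence of consecutive cancellations means that $D=E-\sum_{i,j}b_{i,j}C^{i,j}$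 for non-negative rational numbers $b_{i,j}$ (finitely many nonzero), $D$ having non-negative entries. *)

(* Defs.v *)
From mathcomp Require Import all_boot all_order all_algebra.
From mathcomp Require Import finmap.

Set Implicit Arguments.
Unset Strict Implicit.
Unset Printing Implicit Defensive.

Import Order.TTheory GRing.Theory Num.Theory.
Local Open Scope fset_scope.
Local Open Scope ring_scope.

(* The entry in row [i] and column [j] of [D] is [D (i, j)]. *)
Notation ratmx_fin := {fsfun int * int -> rat with 0}.

(* Q[t, 1/t] is seen inside the field of rational functions Q(t): its elements
   are the products u * t ^ m with u a polynomial and m an integer; [Xt] is t. *)
Notation ratfun := {fraction {poly rat}}.

Definition Xt : ratfun := tofrac 'X.

Definition is_laurent (f : ratfun) : Prop :=
  exists (u : {poly rat}) (m : int), f = tofrac u * Xt ^ m.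

Definition laurent_dvd (f g : ratfun) : Prop :=
  exists q : ratfun, is_laurent q /\ g = f * q.

Definition alt_series (D : ratmx_fin) : ratfun :=
  \sum_(k <- finsupp D) tofrac ((-1) ^ k.1 * D k)%:P * Xt ^ k.2.

Definition is_diagram (p : nat) (D : ratmx_fin) : Prop :=
  (forall i j : int, ~~ (0 <= i <= p%:Z) -> D (i, j) = 0)
  /\ laurent_dvd ((1 - Xt) ^+ p) (alt_series D).

Definition increasing_seq (p : nat) (d : 'I_p.+1 -> int) : Prop :=
  forall i k : 'I_p.+1, (i < k)%N -> d i < d k.

(* [is_pi d P] says that P = pi(d). *)
Definition is_pi (p : nat) (d : 'I_p.+1 -> int) (P : ratmx_fin) : Prop :=
  [/\ is_diagram p P,
      forall (i : 'I_p.+1) (j : int), j != d i -> P (i%:Z, j) = 0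
    & P (0, d ord0) = 1].

Definition pure_diagram (p : nat) (P : ratmx_fin) : Prop :=
  exists d : 'I_p.+1 -> int, increasing_seq d /\ is_pi d P.

(* For p = 0 the condition holds for every [d] (take d0 = j = c), in accordance
   with the convention that all pure diagrams of codimension 0 are extremely
   compressed. *)
Definition extremely_compressed_type (p : nat) (d : 'I_p.+1 -> int) : Prop :=
  exists d0 j c : int, d0 <= j <= c /\
    forall i : 'I_p.+1,
      d i = if i == 0 :> nat then d0
            else if (i < p)%N then j + i%:Z
            else c + p%:Z.

Definition extremely_compressed (p : nat) (P : ratmx_fin) : Prop :=
  exists d : 'I_p.+1 -> int,
    [/\ increasing_seq d, extremely_compressed_type d & is_pi d P].

Definition nonneg_combination (S : ratmx_fin -> Prop) (D : ratmx_fin) : Prop :=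
  exists (n : nat) (a : 'I_n -> rat) (P : 'I_n -> ratmx_fin),
    [/\ forall k, 0 <= a k, forall k, S (P k)
      & forall i j : int, D (i, j) = \sum_(k < n) a k * P k (i, j)].

(* The diagram C^{k,l} with kl = (k, l). *)
Definition cancel_diagram (kl : int * int) : ratmx_fin :=
  [fsfun x in [fset kl; (kl.1 + 1, kl.2)] => 1 | 0].

Definition obtained_by_cancellations (D E : ratmx_fin) : Prop :=
  exists b : ratmx_fin,
    [/\ forall i j : int, 0 <= b (i, j),
        forall i j : int, 0 <= D (i, j)
      & forall i j : int,
          D (i, j) = E (i, j)
                     - \sum_(kl <- finsupp b) b kl * cancel_diagram kl (i, j)].

(* Main.v *)
Require Import Defs.
From mathcomp Require Import all_boot all_order all_algebra.
From mathcomp Require Import finmap.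
From mathcomp Require Import zify ring.

Import Order.TTheory GRing.Theory Num.Theory.
Local Open Scope ring_scope.

(* Divisibility of sum_k c_k t^(n_k) by (1 - t)^p means that
   sum_k c_k q(n_k) = 0 for all polynomials q of degree < p, so a pure diagram
   is given by the weights of a divided difference: the entry of pi(d) in row i
   is prod_(k <> 0, i) (d_k - d_0) / |d_k - d_i|.
   By linearity one may take D = pi(d).  If d_1, ..., d_(p-1) are not
   consecutive, insert a missing integer m between two of them to get an
   increasing sequence e of p + 2 degrees.  Up to sign, the entry of degree x
   in the pure diagram omitting the degree z from e is a factor independent
   of z times 1 - (x - d_0) / (z - d_0), which is affine in 1 / (z - d_0).
   Hence pi(d), which omits m, has the same alternating series as a convex
   combination of the pure diagrams omitting d_1 and d_(p-1).  A degree x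
   strictly between d_1 and d_(p-1) may sit in two adjacent rows of these
   diagrams, and comparing signs shows that the combination exceeds pi(d) by
   non-negative multiples of diagrams C^(k,x) with 1 <= k <= p - 2.  Both new
   types have a smaller spread between their entries of index 1 and p - 1, so
   the process stops at extremely compressed types, leaving rows 0 and p
   untouched. *)

(** * Divisibility by powers of [1 - t] *)

(* The Euler operator t d/dt, for which the [t ^ n] are eigenvectors. *)
Definition theta (F : {poly rat}) : {poly rat} := 'X * F^`().

Lemma theta_XsubC_exp (m : nat) (q : {poly rat}) :
  theta (('X - 1%:P) ^+ m.+1 * q) =
  ('X - 1%:P) ^+ m * ('X * (q *+ m.+1 + ('X - 1%:P) * q^`())).
Proof.
rewrite /theta derivM deriv_exp derivXsubC mul1r /= exprS mulrnAl -mulrnAr.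
by rewrite -!mulrA (mulrCA ('X - 1%:P)) -mulrDr mulrCA.
Qed.

(** Each [theta] removes one factor [X - 1] and multiplies the value of the cofactor at 1 by the old
    exponent, whence the falling factorial. For [j > 0] both sides vanish; [j = 0] is the first
    iterate that sees the cofactor. *)
Lemma iter_theta_XsubC_exp (i j : nat) (q : {poly rat}) :
  (iter i theta (('X - 1%:P) ^+ (i + j) * q)).[1] =
  ((i + j) ^_ i)%:R * (('X - 1%:P) ^+ j * q).[1].
Proof.
elim: i q => [|i IHi] q; first by rewrite ffactn0 mul1r.
rewrite addSn iterSr theta_XsubC_exp IHi ffactSS natrM 2!hornerM hornerX mul1r.
rewrite hornerD hornerM hornerXsubC subrr mul0r addr0 hornerMn hornerM.
by rewrite (mulrnAr _ q.[1]) (mulrnAr _ (_ * q.[1])) -[RHS]mulrA mulr_natl.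
Qed.

(** Iterates of [theta] replace derivatives as a test for the multiplicity of the root 1, because
    their values at 1 are power moments of the exponents. If the multiplicity [m] were below [p],
    the [m]-th iterate would take the nonzero value m! q(1). *)
Lemma XsubC_exp_dvd_iter_theta (p : nat) (F : {poly rat}) :
  (exists u, F = ('X - 1%:P) ^+ p * u) <->
  (forall i, (i < p)%N -> (iter i theta F).[1] = 0).
Proof.
split=> [[u ->] i ltip | F0].
  rewrite -(subnKC (ltnW ltip)) iter_theta_XsubC_exp.
  by rewrite -(subnSK ltip) exprS !hornerM hornerXsubC subrr !mul0r mulr0.
have [->|nzF] := eqVneq F 0; first by exists 0; rewrite mulr0.
have [m [q nrq defF]] := multiplicity_XsubC F 1.
rewrite nzF /= in nrq.
have [le_pm | lt_mp] := leqP p m.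
  exists (('X - 1%:P) ^+ (m - p) * q); rewrite defF mulrA -exprD subnKC //.
  by rewrite mulrC.
have /eqP := F0 m lt_mp; rewrite defF mulrC -[in _ ^+ m](addn0 m).
rewrite iter_theta_XsubC_exp addn0 ffactnn expr0 mul1r mulf_eq0.
by rewrite pnatr_eq0 -leqn0 leqNgt fact_gt0 -rootE (negPf nrq).
Qed.

Lemma iter_theta_sum (K : Type) (s : seq K) (c : K -> rat) (m : K -> nat) i :
  iter i theta (\sum_(k <- s) c k *: 'X^(m k)) =
  \sum_(k <- s) (c k * (m k)%:R ^+ i) *: 'X^(m k).
Proof.
elim: i => [|i IHi] /=; first by apply: eq_bigr => k _; rewrite mulr1.
rewrite IHi /theta raddf_sum mulr_sumr /=; apply: eq_bigr => k _.
rewrite derivZ derivXn -scaler_nat scalerA -scalerAr exprSr mulrA.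
by case: (m k) => [|n]; rewrite ?mulr0 ?scale0r // -exprS.
Qed.

(** The value at 1 of the [i]-th iterate is the moment of ['X^i], and the monomials with [i < p]
    span the test polynomials. *)
Lemma poly_XsubC_exp_dvdP p (K : Type) (s : seq K) (c : K -> rat) (m : K -> nat) :
  (exists u, \sum_(k <- s) c k *: 'X^(m k) = ('X - 1%:P) ^+ p * u) <->
  (forall q : {poly rat}, (size q <= p)%N ->
     \sum_(k <- s) c k * q.[(m k)%:R] = 0).
Proof.
have ev i : (iter i theta (\sum_(k <- s) c k *: 'X^(m k))).[1] =
            \sum_(k <- s) c k * (m k)%:R ^+ i.
  rewrite iter_theta_sum horner_sum; apply: eq_bigr => k _.
  by rewrite hornerZ hornerXn expr1n mulr1.
rewrite XsubC_exp_dvd_iter_theta; split=> [F0 q le_q_p | F0 i lt_ip].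
  under eq_bigr => k _ do rewrite (horner_coef_wide _ le_q_p) mulr_sumr.
  rewrite exchange_big big1 // => i _.
  under eq_bigr => k _ do rewrite mulrCA.
  by rewrite -mulr_sumr -ev F0 ?mulr0.
have := F0 'X^i; rewrite size_polyXn ev => /(_ lt_ip) Fi0.
by under eq_bigr => k _ do rewrite -hornerXn.
Qed.

Lemma Xt_neq0 : Xt != 0.
Proof. by rewrite tofrac_eq0 polyX_eq0. Qed.

Lemma Xt_pos_exp (n : int) : 0 <= n -> Xt ^ n = tofrac 'X^`|n|.
Proof. by case: n => // n _; rewrite tofracXn. Qed.

Lemma one_sub_Xt_exp p : (1 - Xt) ^+ p = tofrac ((-1) ^+ p * ('X - 1%:P) ^+ p).
Proof. by rewrite -exprMn mulN1r opprB tofracXn tofracB. Qed.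

(** Multiplying by a large power of t makes all exponents natural numbers. This translates them, and
    polynomials of bounded degree are stable under translation, so the moment conditions do not
    change. *)
Lemma laurent_dvd_one_sub_XtP p (K : eqType) (s : seq K) (c : K -> rat)
    (n : K -> int) :
  laurent_dvd ((1 - Xt) ^+ p) (\sum_(k <- s) tofrac (c k)%:P * Xt ^ n k) <->
  (forall q : {poly rat}, (size q <= p)%N ->
     \sum_(k <- s) c k * q.[(n k)%:~R] = 0).
Proof.
pose N0 : nat := \sum_(k <- s) `|n k|%N.
have N0P k : k \in s -> (`|n k| <= N0)%N.
  by move=> sk; rewrite /N0 (big_rem k) //= leq_addr.
have shift (N : nat) : (N0 <= N)%N ->
    (\sum_(k <- s) tofrac (c k)%:P * Xt ^ n k) * Xt ^ N%:Z =
    tofrac (\sum_(k <- s) c k *: 'X^`|n k + N%:Z|).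
  move=> leN; rewrite mulr_suml raddf_sum /= !big_seq; apply: eq_bigr => k sk.
  rewrite -mulrA -expfzDr ?Xt_neq0 // Xt_pos_exp -?tofracM ?mul_polyC //.
  by have := N0P k sk; lia.
have moments (N : nat) : (N0 <= N)%N ->
    (forall q : {poly rat}, (size q <= p)%N ->
      \sum_(k <- s) c k * q.[`|n k + N%:Z|%:R] = 0) <->
    (forall q : {poly rat}, (size q <= p)%N ->
      \sum_(k <- s) c k * q.[(n k)%:~R] = 0).
  move=> leN.
  have nE k : k \in s -> `|n k + N%:Z|%:R = (n k)%:~R + N%:R :> rat.
    move=> sk; rewrite !pmulrn -intrD.
    by congr (_%:~R); have := N0P k sk; lia.
  split=> F0 q szq.
    have := F0 (q \Po ('X - N%:R%:P)).
    rewrite size_comp_poly2 ?size_XsubC // => /(_ szq) Fq; rewrite -[RHS]Fq.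
    rewrite [LHS]big_seq [RHS]big_seq; apply: eq_bigr => k sk.
    by rewrite horner_comp nE // !hornerE addrK.
  have := F0 (q \Po ('X + N%:R%:P)).
  rewrite size_comp_poly2 ?size_XaddC // => /(_ szq) Fq; rewrite -[RHS]Fq.
  rewrite [LHS]big_seq [RHS]big_seq; apply: eq_bigr => k sk.
  by rewrite horner_comp nE // !hornerE.
split=> [[f [[u [m ->]]]] defF | F0].
  (* The summand [|m|] makes the exponent in the quotient non-negative as well. *)
  pose N := (N0 + `|m|)%N.
  have leN : (N0 <= N)%N by rewrite leq_addr.
  apply/(moments N leN)/poly_XsubC_exp_dvdP.
  exists ((-1) ^+ p * (u * 'X^`|m + N%:Z|)); apply/eqP; rewrite -tofrac_eq.
  rewrite -shift // defF one_sub_Xt_exp -!mulrA -expfzDr ?Xt_neq0 //.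
  rewrite Xt_pos_exp; last by rewrite /N; lia.
  by rewrite -!tofracM; apply/eqP; congr tofrac; ring.
have [u defu] := (poly_XsubC_exp_dvdP p _ s c (fun k => `|(n k + N0%:Z)%R|%N)).2
   ((moments N0 (leqnn _)).2 F0).
exists (tofrac ((-1) ^+ p * u) * Xt ^ (- N0%:Z)).
split; first by exists ((-1) ^+ p * u), (- N0%:Z).
apply: (mulIf (expfz_neq0 N0%:Z Xt_neq0)).
rewrite shift // defu -!mulrA -expfzDr ?Xt_neq0 // addNr expr0z mulr1.
rewrite one_sub_Xt_exp -tofracM; congr tofrac.
by rewrite mulrACA -expr2 exprAC sqrrN expr1n expr1n mul1r.
Qed.

(** * Finitely supported matrices *)

Definition delta_sum (I : finType) (c : I -> rat) (x : I -> int * int) :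
    ratmx_fin :=
  [fsfun y in [fset x i | i in I]%fset => \sum_i c i *+ (y == x i) | 0].

Lemma delta_sumE (I : finType) (c : I -> rat) (x : I -> int * int) y :
  delta_sum I c x y = \sum_i c i *+ (y == x i).
Proof.
rewrite fsfunE; case: ifP => // /negP nxy; rewrite big1 // => i _.
by case: eqP => // yx; case: nxy; rewrite yx; apply/imfsetP; exists i.
Qed.

Definition fs_lin (u v : rat) (f g : ratmx_fin) : ratmx_fin :=
  [fsfun y in (finsupp f `|` finsupp g)%fset => u * f y + v * g y | 0].

Lemma fs_linE (u v : rat) (f g : ratmx_fin) y :
  fs_lin u v f g y = u * f y + v * g y.
Proof.
rewrite fsfunE; case: ifP => // /negbT; rewrite in_fsetU negb_or.
by case/andP=> /fsfun_dflt -> /fsfun_dflt ->; rewrite !mulr0 addr0.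
Qed.

Lemma sum_finsupp_sub (f : ratmx_fin) (A : {fset int * int}) (g : int * int -> rat) :
  (finsupp f `<=` A)%fset ->
  \sum_(y <- finsupp f) f y * g y = \sum_(y <- A) f y * g y.
Proof.
by move=> sfA; apply: big_fset_incl => // y _ /fsfun_dflt ->; rewrite mul0r.
Qed.

(** The support of [f] may be smaller than the set of points [x i], since coefficients may vanish;
    the sum is therefore taken over the union of both sets. *)
Lemma sum_finsupp_delta (I : finType) (c : I -> rat) (x : I -> int * int)
    (f : ratmx_fin) (g : int * int -> rat) :
  (forall y, f y = \sum_i c i *+ (y == x i)) ->
  \sum_(y <- finsupp f) f y * g y = \sum_i c i * g (x i).
Proof.
move=> fE; pose A := (finsupp f `|` [fset x i | i in I])%fset.
rewrite (sum_finsupp_sub f A) ?fsubsetUl //.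
under eq_bigr => y _ do rewrite fE mulr_suml.
rewrite exchange_big; apply: eq_bigr => i _.
rewrite (bigD1_seq (x i)) ?fset_uniq //=; last first.
  by rewrite in_fsetU; apply/orP; right; apply/imfsetP; exists i.
rewrite eqxx big1 ?addr0 // => y /negPf ->; exact: mul0r.
Qed.

Lemma sum_finsupp_lin n (a : 'I_n -> rat) (P : 'I_n -> ratmx_fin)
    (f : ratmx_fin) (g : int * int -> rat) :
  (forall y, f y = \sum_l a l * P l y) ->
  \sum_(y <- finsupp f) f y * g y =
  \sum_l a l * \sum_(y <- finsupp (P l)) P l y * g y.
Proof.
move=> fE; pose A := (finsupp f `|` \bigcup_(l <- enum 'I_n) finsupp (P l))%fset.
have sA l : (finsupp (P l) `<=` A)%fset.
  apply: fsubset_trans (fsubsetUr _ _).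
  by apply: (@bigfcup_sup _ _ _ l predT (fun i => finsupp (P i))); rewrite ?mem_enum.
rewrite (sum_finsupp_sub f A) ?fsubsetUl //.
under eq_bigr => y _ do rewrite fE mulr_suml.
rewrite exchange_big; apply: eq_bigr => l _.
rewrite (sum_finsupp_sub (P l) A) // mulr_sumr.
by apply: eq_bigr => y _; rewrite mulrA.
Qed.

(** The sign of each row moves into the test function, which turns divisibility into linear
    equations in [D]. *)
Lemma is_diagramP p (D : ratmx_fin) :
  is_diagram p D <->
  (forall i j : int, ~~ (0 <= i <= p%:Z) -> D (i, j) = 0) /\
  (forall q : {poly rat}, (size q <= p)%N ->
     \sum_(y <- finsupp D) D y * ((-1) ^ y.1 * q.[y.2%:~R]) = 0).
Proof.
rewrite /is_diagram /alt_series.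
have [dvdF Fdvd] := laurent_dvd_one_sub_XtP p _ (finsupp D)
  (fun y => (-1) ^ y.1 * D y) snd.
split=> [[rows /dvdF F0] | [rows F0]]; split=> //.
  by move=> q szq; rewrite -[RHS](F0 q szq); apply: eq_bigr => y _;
     rewrite mulrA (mulrC (D y)).
apply: Fdvd => q szq; rewrite -[RHS](F0 q szq).
by apply: eq_bigr => y _; rewrite mulrA (mulrC (D y)).
Qed.

Lemma nonneg_combination_is_diagram p (S : ratmx_fin -> Prop) (D : ratmx_fin) :
  (forall P, S P -> is_diagram p P) -> nonneg_combination S D -> is_diagram p D.
Proof.
move=> Sdiag [n [a [P [_ SP DE]]]]; apply/is_diagramP; split=> [i j nij | q szq].
  rewrite DE big1 // => k _.
  by have [/(_ i j nij) -> _] := Sdiag _ (SP k); rewrite mulr0.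
rewrite (sum_finsupp_lin n a P); last by case.
apply: big1 => k _.
by have /is_diagramP[_ /(_ q szq) ->] := Sdiag _ (SP k); rewrite mulr0.
Qed.

(** * Pure diagrams *)

Lemma prod_XsubC_neqE (n : nat) (x : 'I_n.+1 -> rat) (i : 'I_n.+1) :
  \prod_(k | k != i) ('X - (x k)%:P) =
  \prod_(k <- enum (predC1 i)) ('X - (x k)%:P).
Proof. by rewrite big_enum; apply: eq_bigl. Qed.

Lemma size_prod_XsubC_neq (n : nat) (x : 'I_n.+1 -> rat) (i : 'I_n.+1) :
  size (\prod_(k | k != i) ('X - (x k)%:P)) = n.+1.
Proof. by rewrite prod_XsubC_neqE size_prod_XsubC -cardE cardC1 card_ord. Qed.

Lemma horner_prod_XsubC_neq (n : nat) (x : 'I_n.+1 -> rat) (i j : 'I_n.+1) :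
  i != j -> (\prod_(k | k != i) ('X - (x k)%:P)).[x j] = 0.
Proof.
move=> neq_ij; rewrite horner_prod (bigD1 j) 1?eq_sym //= hornerXsubC subrr.
exact: mul0r.
Qed.

(* The interpolation polynomial of [q] at the [x i] is [q] itself, so its
   coefficient of degree [n] vanishes. *)
Lemma sum_divided_difference (n : nat) (x : 'I_n.+1 -> rat) (q : {poly rat}) :
  injective x -> (size q <= n)%N ->
  \sum_i q.[x i] / \prod_(k | k != i) (x i - x k) = 0.
Proof.
move=> injx szq.
pose w i := \prod_(k | k != i) (x i - x k).
have nzw i : w i != 0.
  apply/prodf_neq0 => k neq_ki; rewrite subr_eq0.
  by apply: contra_neq neq_ki => /injx.
pose L i := \prod_(k | k != i) ('X - (x k)%:P).
pose Q := q - \sum_i (q.[x i] / w i) *: L i.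
(* [Q] has degree at most [n] and vanishes at [n + 1] distinct points. *)
have Q0 : Q = 0.
  apply: (@roots_geq_poly_eq0 _ _ [seq x i | i : 'I_n.+1]).
  - apply/allP => _ /imageP[j _ ->]; rewrite rootE /Q hornerD hornerN horner_sum.
    rewrite (bigD1 j) //= big1 ?addr0 => [|i neq_ij].
      rewrite hornerZ horner_prod.
      under [X in _ / _ * X]eq_bigr => k _ do rewrite hornerXsubC.
      by rewrite divfK ?subrr ?nzw.
    by rewrite hornerZ horner_prod_XsubC_neq ?mulr0.
  - by rewrite map_inj_uniq ?enum_uniq.
  - rewrite size_image card_ord (leq_trans (size_polyD _ _)) // geq_max.
    rewrite (leq_trans szq) // size_polyN.
    apply: (leq_trans (size_sum _ _ _)); apply/bigmax_leqP => i _.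
    by rewrite (leq_trans (size_scale_leq _ _)) // size_prod_XsubC_neq.
have /(congr1 (fun r : {poly rat} => r`_n)) := Q0.
rewrite coef0 coefB nth_default // coef_sum sub0r => /eqP.
rewrite oppr_eq0 => /eqP Qn; rewrite -[RHS]Qn; apply: eq_bigr => i _.
have /monicP := monic_prod_XsubC (enum (predC1 i)) predT x.
rewrite lead_coefE -prod_XsubC_neqE size_prod_XsubC_neq coefZ => /= ->.
by rewrite mulr1.
Qed.

(** The solution of the Herzog-Kühl equations, normalised in row 0: for [i = ord0] and increasing
    [d] every quotient is 1. *)
Definition pi_entry (p : nat) (d : 'I_p.+1 -> int) (i : 'I_p.+1) : rat :=
  \prod_(k | (k != ord0) && (k != i))
    ((d k - d ord0)%:~R / `|(d k - d i)%:~R|).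

Definition pi_diagram (p : nat) (d : 'I_p.+1 -> int) : ratmx_fin :=
  delta_sum 'I_p.+1 (pi_entry p d) (fun i => (i%:Z, d i)).

Lemma increasing_seq_lt (p : nat) (d : 'I_p.+1 -> int) i k :
  increasing_seq d -> (d i < d k) = (i < k)%N.
Proof.
move=> dinc; have [lt_ik | lt_ki | /val_inj ->] := ltngtP i k.
- exact: dinc.
- by apply/negbTE; rewrite -leNgt ltW ?dinc.
- by rewrite ltxx.
Qed.

Lemma increasing_seq_inj (p : nat) (d : 'I_p.+1 -> int) :
  increasing_seq d -> injective d.
Proof.
move=> dinc i k eq_d; apply/val_inj.
case: (ltngtP i k) => // lt_ik; have := dinc _ _ lt_ik.
  by rewrite eq_d ltxx.
by rewrite eq_d ltxx.
Qed.

Lemma pi_entry_ge0 (p : nat) (d : 'I_p.+1 -> int) i :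
  increasing_seq d -> 0 <= pi_entry p d i.
Proof.
move=> dinc; apply: prodr_ge0 => k /andP[nz_k _].
by rewrite divr_ge0 // ler0z subr_ge0 ltW // dinc // lt0n.
Qed.

Lemma pi_entry0 (p : nat) (d : 'I_p.+1 -> int) :
  increasing_seq d -> pi_entry p d ord0 = 1.
Proof.
move=> dinc; apply: big1 => k /andP[nz_k _].
have lt_d : 0 < d k - d ord0 by rewrite subr_gt0 dinc // lt0n.
by rewrite ger0_norm ?ler0z ?ltW // divff // intr_eq0 gt_eqF.
Qed.

Lemma pi_diagramE (p : nat) (d : 'I_p.+1 -> int) (i : 'I_p.+1) :
  pi_diagram p d (i%:Z, d i) = pi_entry p d i.
Proof.
rewrite delta_sumE (bigD1 i) //= eqxx big1 ?addr0 // => k neq_ki.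
by rewrite xpair_eqE eqz_nat val_eqE eq_sym (negPf neq_ki).
Qed.

Lemma pi_diagram_eq0 (p : nat) (d : 'I_p.+1 -> int) (y : int * int) :
  (forall i : 'I_p.+1, y != (i%:Z, d i)) -> pi_diagram p d y = 0.
Proof. by move=> ny; rewrite delta_sumE big1 // => i _; rewrite (negPf (ny i)). Qed.

Lemma sum_ltn_ord (n i : nat) : (\sum_(k < n) (i < k) = n - i.+1)%N.
Proof.
elim: n => [|n IHn]; first by rewrite big_ord0.
by rewrite big_ord_recr /= IHn; lia.
Qed.

(** Exactly the [p - i] factors with [k > i] change sign when the absolute values are dropped, and
    the sign of row [i] makes the total sign independent of [i]. The signed entries are thus a
    constant times the weights of a divided difference. *)
Lemma signed_pi_entry (p : nat) (d : 'I_p.+1 -> int) (i : 'I_p.+1) :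
  increasing_seq d ->
  (-1) ^+ i * pi_entry p d i =
  (-1) ^+ p * (\prod_(k | k != ord0) (d k - d ord0)%:~R) /
    \prod_(k | k != i) ((d i)%:~R - (d k)%:~R).
Proof.
move=> dinc.
have nzd (j k : 'I_p.+1) : j != k -> (d j - d k)%:~R != 0 :> rat.
  by move=> neq; rewrite intr_eq0 subr_eq0 (inj_eq (increasing_seq_inj p d dinc)).
have absE (k : 'I_p.+1) : k != i ->
    `|(d k - d i)%:~R| = (-1) ^+ (i < k)%N * ((d i)%:~R - (d k)%:~R) :> rat.
  move=> neq_ki; case: ltnP => [lt_ik|le_ki].
    by rewrite ger0_norm ?ler0z ?subr_ge0 ?ltW ?dinc // expr1 intrB; ring.
  rewrite ler0_norm; first by rewrite expr0 intrB; ring.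
  by rewrite lerz0 subr_le0 ltW // dinc // ltn_neqAle neq_ki.
have prod_abs : \prod_(k | k != i) `|(d k - d i)%:~R| =
    (-1) ^+ (p - i) * \prod_(k | k != i) ((d i)%:~R - (d k)%:~R) :> rat.
  rewrite (eq_bigr _ absE) big_split /= prodrXr; congr (_ ^+ _ * _).
  have := sum_ltn_ord p.+1 i; rewrite (bigD1 i) //= ltnn add0n => ->.
  by rewrite subSS.
have nzw : \prod_(k | k != i) ((d i)%:~R - (d k)%:~R) != 0 :> rat.
  by apply/prodf_neq0 => k neq_ki; rewrite -intrB nzd // eq_sym.
have entryE : pi_entry p d i * \prod_(k | k != i) `|(d k - d i)%:~R| =
    \prod_(k | k != ord0) (d k - d ord0)%:~R.
  have [-> | nz_i] := eqVneq i ord0.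
    rewrite pi_entry0 // mul1r; apply: eq_bigr => k nz_k.
    by rewrite ger0_norm // ler0z subr_ge0 ltW // dinc // lt0n.
  (* The factor for [k = i] on the right equals the factor for [k = ord0] on the left. *)
  rewrite [in RHS](bigD1 i) //= (bigD1 ord0) 1?eq_sym //= mulrCA.
  congr (_ * _).
    by rewrite intrB distrC -intrB ger0_norm // ler0z subr_ge0 ltW // dinc // lt0n.
  rewrite /pi_entry; under [X in _ * X]eq_bigl => k do rewrite andbC.
  rewrite -big_split; apply: eq_bigr => k /andP[_ neq_ki] /=.
  by rewrite divfK // normr_eq0 nzd.
have sgn : (-1) ^+ i = (-1) ^+ p * (-1) ^+ (p - i) :> rat.
  have le_ip : (i <= p)%N by rewrite -ltnS.
  rewrite -exprD -signr_odd -[RHS]signr_odd oddD oddB //.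
  by case: (odd p); case: (odd i).
apply: (mulIf nzw); rewrite divfK // -entryE prod_abs sgn -!mulrA.
by congr (_ * _); rewrite mulrCA.
Qed.

Lemma row_outside (p : nat) (D : ratmx_fin) (i j : int) :
  is_diagram p D -> ~~ (0 <= i <= p%:Z) -> D (i, j) = 0.
Proof. by case=> rows _; apply: rows. Qed.

Lemma pi_diagram_moment (p : nat) (d : 'I_p.+1 -> int) (q : {poly rat}) :
  increasing_seq d -> (size q <= p)%N ->
  \sum_i pi_entry p d i * ((-1) ^+ i * q.[(d i)%:~R]) = 0.
Proof.
move=> dinc szq.
pose C : rat := (-1) ^+ p * \prod_(k | k != ord0) (d k - d ord0)%:~R.
have injd : injective (fun i => (d i)%:~R : rat).
  by move=> i k /intr_inj/(increasing_seq_inj p d dinc).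
have /(congr1 ( *%R C)) := sum_divided_difference p _ q injd szq.
rewrite mulr0 mulr_sumr => sum0; rewrite -[RHS]sum0; apply: eq_bigr => i _.
rewrite mulrA (mulrC (pi_entry _ _ _)) signed_pi_entry //.
by rewrite -/C mulrAC mulrA.
Qed.

Lemma pi_diagram_is_pi (p : nat) (d : 'I_p.+1 -> int) :
  increasing_seq d -> is_pi d (pi_diagram p d).
Proof.
move=> dinc; split=> [|i j neq_j|].
- apply/is_diagramP; split=> [i j nij | q szq].
    apply: pi_diagram_eq0 => k; apply: contra nij.
    rewrite xpair_eqE => /andP[/eqP-> _].
    by have := ltn_ord k; lia.
  rewrite (sum_finsupp_delta _ _ _ _ _ (delta_sumE _ _ _)).
  exact: pi_diagram_moment.
- apply: pi_diagram_eq0 => k; apply: contra neq_j.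
  by rewrite xpair_eqE eqz_nat val_eqE => /andP[/eqP-> /eqP->].
exact: etrans (pi_diagramE p d ord0) (pi_entry0 p d dinc).
Qed.

(** A row of a pure diagram has at most one nonzero entry. This brings an arbitrary pure diagram
    into the form that [sum_finsupp_delta] expects. *)
Lemma is_pi_delta (p : nat) (d : 'I_p.+1 -> int) (P : ratmx_fin) y :
  is_pi d P -> P y = \sum_(i < p.+1) P (i%:Z, d i) *+ (y == (i%:Z, d i)).
Proof.
move=> [diagP offP _]; case: y => i j.
have [i_in | i_out] := boolP (0 <= i <= p%:Z); last first.
  rewrite (row_outside p) // big1 // => k _; rewrite xpair_eqE.
  case: eqP => // ik; case/negP: i_out; rewrite ik.
  by have := ltn_ord k; lia.
have lt_ip : (`|i| < p.+1)%N by lia.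
pose k := Ordinal lt_ip; have -> : i = k%:Z by rewrite /=; lia.
rewrite (bigD1 k) //= big1 ?addr0 => [|l neq_lk].
  rewrite xpair_eqE eqxx /=; case: eqP => [-> // | /eqP neq_j].
  exact: (offP k).
by rewrite xpair_eqE eqz_nat -[_ == _ :> nat]/(k == l) eq_sym (negPf neq_lk).
Qed.

(* The difference of two solutions has no entry in row 0; testing it against
   the product of all [X - d k] with [k != 0, i] isolates its entry in row i. *)
Lemma is_pi_unique (p : nat) (d : 'I_p.+1 -> int) (P P' : ratmx_fin) :
  increasing_seq d -> is_pi d P -> is_pi d P' -> P =1 P'.
Proof.
move=> dinc piP piP' y.
rewrite (is_pi_delta p d P) // (is_pi_delta p d P') //.
apply: eq_bigr => i _; congr (_ *+ _).
have [_ _ P0] := piP; have [_ _ P'0] := piP'.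
have [-> | nz_i] := eqVneq i ord0; first by rewrite P0 P'0.
(* There are [p - 1] linear factors, so [q] is an admissible test polynomial. *)
pose q : {poly rat} := \prod_(k in [set~ ord0] :\ i) ('X - ((d k)%:~R)%:P).
have szq : (size q <= p)%N.
  rewrite /q -big_enum size_prod_XsubC -cardE.
  have := cardsD1 i [set~ ord0]; rewrite cardsC1 card_ord !inE nz_i /=; lia.
have moment Q : is_pi d Q ->
    \sum_(k < p.+1) Q (k%:Z, d k) * ((-1) ^+ k * q.[(d k)%:~R]) = 0.
  move=> piQ; have [/is_diagramP[_ /(_ q szq) Q0] _ _] := piQ.
  rewrite -[RHS]Q0; apply/esym.
  exact: (sum_finsupp_delta _ _ _ _ _ (fun y => is_pi_delta p d Q y piQ)).
have isolate Q : is_pi d Q -> Q (i%:Z, d i) * ((-1) ^+ i * q.[(d i)%:~R]) =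
    - q.[(d ord0)%:~R].
  move=> piQ; have := moment Q piQ; have [_ _ Q0] := piQ.
  rewrite (bigD1 ord0) //= (bigD1 i) //= Q0 expr0 !mul1r big1 ?addr0.
    by move/eqP; rewrite addrC addr_eq0 => /eqP.
  move=> k /andP[nz_k neq_ki].
  rewrite horner_prod (bigD1 k) ?inE ?neq_ki //= hornerXsubC subrr.
  by rewrite mul0r !mulr0.
have nzq : (-1) ^+ i * q.[(d i)%:~R] != 0.
  rewrite mulf_neq0 ?expf_neq0 // horner_prod; apply/prodf_neq0 => k.
  rewrite !inE => /andP[neq_ki _]; rewrite hornerXsubC subr_eq0.
  by apply: contra_neq neq_ki => /intr_inj/(increasing_seq_inj p d dinc).
by apply: (mulIf nzq); rewrite !isolate.
Qed.

(** * Exchanging one degree of a pure diagram *)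

Lemma increasing_seq_lift (p : nat) (e : 'I_p.+2 -> int) (z : 'I_p.+2) :
  increasing_seq e -> increasing_seq (fun k : 'I_p.+1 => e (lift z k)).
Proof. by move=> einc i k lt_ik; apply: einc; rewrite /= /bump; lia. Qed.

(** Restoring the degree [e z] adds a single factor to the product; the right-hand side divides it
    out again. *)
Lemma pi_entry_lift (p : nat) (e : 'I_p.+2 -> int) (z : 'I_p.+2) (k : 'I_p.+1) :
  increasing_seq e -> z != ord0 ->
  pi_entry p (fun k => e (lift z k)) k =
  pi_entry p.+1 e (lift z k) * `|(e z - e (lift z k))%:~R|
    / (e z - e ord0)%:~R.
Proof.
move=> einc nz_z.
have lift0 : lift z (ord0 : 'I_p.+1) = ord0.
  by move: nz_z; rewrite -val_eqE /= => nz_z; apply/val_inj; rewrite /= /bump; lia.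
have nze (j l : 'I_p.+2) : j != l -> (e j - e l)%:~R != 0 :> rat.
  by move=> neq; rewrite intr_eq0 subr_eq0 (inj_eq (increasing_seq_inj _ e einc)).
rewrite [in RHS]/pi_entry (bigD1_ord z) ?nz_z ?neq_lift //=.
have cancel (u v w : rat) : u != 0 -> v != 0 -> u / v * w * v / u = w.
  by move=> nz_u nz_v; field; rewrite nz_u nz_v.
rewrite cancel ?normr_eq0 ?nze ?neq_lift //.
rewrite /pi_entry lift0; apply: eq_bigl => l.
by rewrite -(inj_eq (@lift_inj _ z) l ord0) lift0 (inj_eq lift_inj).
Qed.

(* The contribution of the degree [e y] to the pure diagram whose type is [e]
   with [e z] omitted; it vanishes for [y = z]. *)
Definition lift_term (p : nat) (e : 'I_p.+2 -> int) (z y : 'I_p.+2)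
    (x : int * int) : rat :=
  (pi_entry p.+1 e y * `|(e z - e y)%:~R| / (e z - e ord0)%:~R)
    *+ (x == ((unbump z y)%:Z, e y)).

Lemma pi_diagram_lift (p : nat) (e : 'I_p.+2 -> int) (z : 'I_p.+2) x :
  increasing_seq e -> z != ord0 ->
  pi_diagram p (fun k => e (lift z k)) x = \sum_y lift_term p e z y x.
Proof.
move=> einc nz_z; rewrite delta_sumE (bigD1_ord z) //=.
rewrite {1}/lift_term subrr normr0 mulr0 mul0r mul0rn add0r.
by apply: eq_bigr => k _; rewrite pi_entry_lift // /lift_term /= bumpK.
Qed.

(* [ua], [uz], [ub] are the distances of three of the degrees to the lowest one;
   the entries of the pure diagram omitting a degree are affine in the inverse
   of its distance. *)
Definition exchange_weight (ua uz ub : rat) : rat :=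
  (uz^-1 - ub^-1) / (ua^-1 - ub^-1).

Lemma exchange_weight_itv (ua uz ub : rat) :
  0 < ua -> ua < uz -> uz < ub -> 0 <= exchange_weight ua uz ub <= 1.
Proof.
move=> ua0 lt_az lt_zb.
have uz0 := lt_trans ua0 lt_az; have ub0 := lt_trans uz0 lt_zb.
have h1 : ub^-1 < uz^-1 by rewrite ltf_pV2.
have h2 : uz^-1 < ua^-1 by rewrite ltf_pV2.
rewrite /exchange_weight ler_pdivrMr ?subr_gt0 ?(lt_trans h1) //.
by rewrite divr_ge0 ?subr_ge0 ?mul1r ?lerD2r // ltW // (lt_trans h1).
Qed.

(** The left side is 1 - u / uz, and the weight writes 1 / uz as an affine combination of 1 / ua and
    1 / ub. *)
Lemma exchange_weightE (ua uz ub u : rat) :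
  0 < ua -> ua < uz -> uz < ub ->
  let w := exchange_weight ua uz ub in
  (uz - u) / uz = w * ((ua - u) / ua) + (1 - w) * ((ub - u) / ub).
Proof.
move=> ua0 lt_az lt_zb /=.
have uz0 := lt_trans ua0 lt_az; have ub0 := lt_trans uz0 lt_zb.
have h1 : ub^-1 < uz^-1 by rewrite ltf_pV2.
have h2 : uz^-1 < ua^-1 by rewrite ltf_pV2.
have h : ua^-1 - ub^-1 != 0 by rewrite subr_eq0 gt_eqF // (lt_trans h1).
have wE : exchange_weight ua uz ub * (ua^-1 - ub^-1) = uz^-1 - ub^-1.
  by rewrite /exchange_weight divfK.
rewrite !mulrBl !divff ?gt_eqF //.
move: (exchange_weight _ _ _) wE => w wE.
have -> : uz^-1 = w * (ua^-1 - ub^-1) + ub^-1 by rewrite wE subrK.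
ring.
Qed.

(** The multiple of the cancellation diagram at row [y - 1], degree [e y], by which the convex
    combination exceeds the diagram omitting [e z]. For a < y <= z only the diagram omitting [e a]
    has this degree in row [y - 1], and for z < y < b only the one omitting [e b] has it in row [y].
    The weighted entry of that diagram is the surplus in both rows. *)
Definition exchange_cancellation (p : nat) (e : 'I_p.+2 -> int)
    (a z b y : 'I_p.+2) : rat :=
  let u k : rat := (e k - e ord0)%:~R in
  let w := exchange_weight (u a) (u z) (u b) in
  if (a < y <= z)%N then w * (pi_entry p.+1 e y * ((u y - u a) / u a))
  else if (z < y < b)%N then (1 - w) * (pi_entry p.+1 e y * ((u b - u y) / u b))
  else 0.

(** Degrees above [e z] drop by one row, and there the absolute value contributes a sign. Up to this
    sign the value is one expression, affine in 1 / u z, on both sides of [z]. *)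
Lemma lift_termE (p : nat) (e : 'I_p.+2 -> int) (z y : 'I_p.+2) x :
  increasing_seq e ->
  let u k : rat := (e k - e ord0)%:~R in
  lift_term p e z y x =
  if (z < y)%N
  then - (pi_entry p.+1 e y * ((u z - u y) / u z)) * (x == (y%:Z - 1, e y))%:R
  else pi_entry p.+1 e y * ((u z - u y) / u z) * (x == (y%:Z, e y))%:R.
Proof.
move=> einc /=; rewrite /lift_term -mulr_natr -intrB.
have -> : e z - e ord0 - (e y - e ord0) = e z - e y by ring.
rewrite /unbump; case: ltnP => [lt_zy | le_yz] /=.
  rewrite ler0_norm; last by rewrite lerz0 subr_le0 ltW // einc.
  have -> : (y - 1)%N%:Z = y%:Z - 1 by lia.
  by rewrite mulrN !mulNr !mulrA.
rewrite ger0_norm ?subn0 ?mulrA // ler0z subr_ge0 leNgt.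
by rewrite (increasing_seq_lt _ e) // -leqNgt.
Qed.

Lemma increasing_seq_gap (p : nat) (e : 'I_p.+2 -> int) (y k : 'I_p.+2) :
  increasing_seq e -> (k < y)%N ->
  (e k - e ord0)%:~R < (e y - e ord0)%:~R :> rat.
Proof. by move=> einc lt_ky; rewrite ltr_int ltrD2r einc. Qed.

(** The position of [y] relative to [a], [z] and [b] decides the rows and signs; in each case the
    claim reduces to the same affine identity. *)
Lemma lift_term_exchange (p : nat) (e : 'I_p.+2 -> int) (a z b y : 'I_p.+2) x :
  increasing_seq e -> (0 < a < z)%N -> (z < b)%N ->
  let u k : rat := (e k - e ord0)%:~R in
  let w := exchange_weight (u a) (u z) (u b) in
  lift_term p e z y x =
  w * lift_term p e a y x + (1 - w) * lift_term p e b y x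
  - exchange_cancellation p e a z b y
    * ((x == (y%:Z - 1, e y))%:R + (x == (y%:Z, e y))%:R).
Proof.
move=> einc /andP[a_gt0 lt_az] lt_zb u w.
have ua0 : 0 < u a by rewrite /u ltr0z subr_gt0 einc.
have key := exchange_weightE (u a) (u z) (u b) (u y) ua0
  (increasing_seq_gap p e _ _ einc lt_az) (increasing_seq_gap p e _ _ einc lt_zb).
rewrite !lift_termE // /exchange_cancellation -/u -/w.
rewrite -[(e a - e ord0)%:~R]/(u a) -[(e b - e ord0)%:~R]/(u b).
rewrite -[(e y - e ord0)%:~R]/(u y) -[(e z - e ord0)%:~R]/(u z).
move: key; rewrite /= -/w.
have [lt_ay | le_ya] := ltnP a y; have [lt_zy | le_yz] := ltnP z y;
  have [lt_by | le_yb] := ltnP b y; rewrite /=; try lia.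
- have -> : (y < b)%N = false by lia.
  by move=> ->; ring.
- have [lt_yb | ge_yb] := ltnP y b; first by move=> ->; ring.
  (* The diagram omitting [e b] contributes 0 here, so the row assigned to this term is
     immaterial. *)
  have -> : y = b by apply/val_inj/eqP; rewrite eqn_leq le_yb.
  by rewrite subrr mul0r => ->; ring.
- by move=> ->; ring.
- by move=> ->; ring.
Qed.

Lemma exchange_cancellation_ge0 (p : nat) (e : 'I_p.+2 -> int)
    (a z b y : 'I_p.+2) :
  increasing_seq e -> (0 < a < z)%N -> (z < b)%N ->
  0 <= exchange_cancellation p e a z b y.
Proof.
move=> einc /andP[a_gt0 lt_az] lt_zb; rewrite /exchange_cancellation.
have gap := increasing_seq_gap p e _ _ einc.
have ua0 : 0 < (e a - e ord0)%:~R :> rat by rewrite ltr0z subr_gt0 einc.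
have ub0 : 0 < (e b - e ord0)%:~R :> rat.
  by apply: lt_trans ua0 (gap _ _ _); apply: ltn_trans lt_zb.
have /andP[w_ge0 w_le1] :=
  exchange_weight_itv _ _ _ ua0 (gap _ _ lt_az) (gap _ _ lt_zb).
have e_ge0 := pi_entry_ge0 p.+1 e y einc.
case: ifP => [/andP[lt_ay _] | _].
  rewrite mulr_ge0 // mulr_ge0 // divr_ge0 ?(ltW ua0) //.
  by rewrite subr_ge0 ltW // gap.
case: ifP => [/andP[_ lt_yb] | //].
rewrite mulr_ge0 ?subr_ge0 // mulr_ge0 // divr_ge0 ?(ltW ub0) //.
by rewrite subr_ge0 ltW // gap.
Qed.

Lemma exchange_cancellation_supp (p : nat) (e : 'I_p.+2 -> int)
    (a z b y : 'I_p.+2) :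
  (a < z < b)%N -> ~~ (a < y < b)%N -> exchange_cancellation p e a z b y = 0.
Proof. by move=> azb nayb; rewrite /exchange_cancellation !ifF //; lia. Qed.

(** * Diagrams compressible by inner cancellations *)

(* Cancellations confined to rows [1, ..., p - 1] do not touch rows [0] and
   [p]. *)
Definition compressible (p : nat) (D : int * int -> rat) : Prop :=
  exists E b : ratmx_fin,
    [/\ nonneg_combination (extremely_compressed p) E,
        forall x, 0 <= b x,
        forall i j : int, ~~ (1 <= i <= p%:Z - 2) -> b (i, j) = 0
      & forall i j : int, D (i, j) = E (i, j) - (b (i, j) + b (i - 1, j))].

Lemma nonneg_combination0 (S : ratmx_fin -> Prop) (f : ratmx_fin) :
  f =1 (fun=> 0) -> nonneg_combination S f.
Proof.
move=> f0; exists 0, (fun=> 0), (fun=> f); split=> [k | [] // | i j] //.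
by rewrite big_ord0 f0.
Qed.

Lemma nonneg_combination_lin (S : ratmx_fin -> Prop) (u v : rat)
    (f g : ratmx_fin) :
  0 <= u -> 0 <= v -> nonneg_combination S f -> nonneg_combination S g ->
  nonneg_combination S (fs_lin u v f g).
Proof.
move=> u0 v0 [m [a [P [a0 SP fE]]]] [n [b [Q [b0 SQ gE]]]].
exists (m + n)%N,
  (fun k => match split k with inl i => u * a i | inr j => v * b j end),
  (fun k => match split k with inl i => P i | inr j => Q j end).
split=> [k | k | i j]; try by case: split => l //; rewrite mulr_ge0.
rewrite fs_linE fE gE big_split_ord /= !mulr_sumr; congr (_ + _).
  by apply: eq_bigr => k _; rewrite (unsplitK (inl k)) mulrA.
by apply: eq_bigr => k _; rewrite (unsplitK (inr k)) mulrA.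
Qed.

Lemma compressible_lin (p : nat) (u v : rat) (f g h : int * int -> rat)
    (c : ratmx_fin) :
  0 <= u -> 0 <= v -> compressible p f -> compressible p g ->
  (forall x, 0 <= c x) ->
  (forall i j : int, ~~ (1 <= i <= p%:Z - 2) -> c (i, j) = 0) ->
  (forall i j : int, h (i, j) =
     u * f (i, j) + v * g (i, j) - (c (i, j) + c (i - 1, j))) ->
  compressible p h.
Proof.
move=> u0 v0 [E1 [b1 [C1 b1_ge0 b1_supp fE]]] [E2 [b2 [C2 b2_ge0 b2_supp gE]]].
move=> c_ge0 c_supp hE.
exists (fs_lin u v E1 E2), (fs_lin 1 1 (fs_lin u v b1 b2) c); split.
- exact: nonneg_combination_lin.
- by move=> x; rewrite !fs_linE !mul1r !addr_ge0 ?mulr_ge0.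
- by move=> i j nij; rewrite !fs_linE b1_supp // b2_supp // c_supp // !mulr0 !addr0.
by move=> i j; rewrite hE fE gE !fs_linE; ring.
Qed.

(** The bounds 0 < a and b <= p keep the first and last degrees of [e] in all three types, which
    confines the cancellations to inner rows. *)
Lemma compressible_exchange (p : nat) (e : 'I_p.+2 -> int) (a z b : 'I_p.+2) :
  increasing_seq e -> (0 < a < z)%N -> (z < b <= p)%N ->
  compressible p (pi_diagram p (fun k => e (lift a k))) ->
  compressible p (pi_diagram p (fun k => e (lift b k))) ->
  compressible p (pi_diagram p (fun k => e (lift z k))).
Proof.
move=> einc a_z /andP[lt_zb le_bp] Ca Cb; have /andP[a_gt0 lt_az] := a_z.
have nz (k : 'I_p.+2) : (0 < k)%N -> k != ord0 by rewrite lt0n.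
have z_gt0 : (0 < z)%N by lia.
have b_gt0 : (0 < b)%N by lia.
pose u k : rat := (e k - e ord0)%:~R.
have /andP[w_ge0 w_le1] : 0 <= exchange_weight (u a) (u z) (u b) <= 1.
  apply: exchange_weight_itv; first by rewrite ltr0z subr_gt0 einc.
    exact: increasing_seq_gap.
  exact: increasing_seq_gap.
pose c := delta_sum 'I_p.+2 (exchange_cancellation p e a z b)
  (fun y => (y%:Z - 1, e y)).
apply: (compressible_lin p _ (1 - exchange_weight (u a) (u z) (u b)) _ _ _ c
  w_ge0 _ Ca Cb) => [|x|i j nij|i j].
- by rewrite subr_ge0.
- rewrite delta_sumE sumr_ge0 // => y _; rewrite mulrn_wge0 //.
  exact: exchange_cancellation_ge0.
(* A nonzero term has a < y < b, hence 2 <= y <= p - 1, and sits in row [y - 1]. *)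
- rewrite delta_sumE big1 // => y _; rewrite xpair_eqE.
  have [ij | //] := eqVneq i (y%:Z - 1).
  by rewrite exchange_cancellation_supp ?mul0rn //; lia.
rewrite !pi_diagram_lift ?nz // !delta_sumE -big_split /= !mulr_sumr.
rewrite -big_split /= -sumrB; apply: eq_bigr => y _.
rewrite (lift_term_exchange p e a z b) // -/(u a) -/(u z) -/(u b).
rewrite -!(mulr_natr (exchange_cancellation _ _ _ _ _ _)) -mulrDr.
by rewrite ![(i - 1, j) == _]xpair_eqE (inj_eq (addIr _)).
Qed.

(** * Reduction to extremely compressed types *)

Lemma eq_pi_diagram (p : nat) (d d' : 'I_p.+1 -> int) :
  d =1 d' -> pi_diagram p d =1 pi_diagram p d'.
Proof.
move=> dd' x; rewrite !delta_sumE; apply: eq_bigr => i _.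
by rewrite dd' /pi_entry; under eq_bigr => k _ do rewrite !dd'.
Qed.

Lemma eq_compressible (p : nat) (f g : int * int -> rat) :
  f =1 g -> compressible p f -> compressible p g.
Proof.
move=> fg [E [b [CE b_ge0 b_supp fE]]]; exists E, b; split=> // i j.
by rewrite -fg fE.
Qed.

Lemma compressible_extremely (p : nat) (d : 'I_p.+1 -> int) :
  increasing_seq d -> extremely_compressed_type d ->
  compressible p (pi_diagram p d).
Proof.
move=> dinc dtype; exists (pi_diagram p d), [fsfun]; split=> [|x|i j _|i j].
- exists 1%N, (fun=> 1), (fun=> pi_diagram p d); split=> // [_ | i j].
    by exists d; split=> //; apply: pi_diagram_is_pi.
  by rewrite big_ord1 mul1r.
- by rewrite fsfun0E.
- by rewrite fsfun0E.
by rewrite !fsfun0E addr0.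
Qed.

(** Only the run of middle degrees has to be checked: the inequalities between the three parameters
    follow from monotonicity. *)
Lemma extremely_compressed_typeP (p : nat) (d : 'I_p.+1 -> int) :
  increasing_seq d ->
  (forall i : nat, (0 < i)%N -> (i.+1 < p)%N -> d (inord i.+1) = d (inord i) + 1) ->
  extremely_compressed_type d.
Proof.
move=> dinc consec.
have inc i k : (i < k)%N -> (k <= p)%N -> d (inord i) < d (inord k).
  by move=> lt_ik le_kp; apply: dinc; rewrite !inordK //; lia.
have dE (i : 'I_p.+1) : d i = d (inord i) by rewrite inord_val.
have [le_p1 | gt_p1] := leqP p 1.
  (* There are no middle degrees, so [j] may be taken equal to [d0]. *)
  exists (d (inord 0)), (d (inord 0)), (d (inord p) - p%:Z); split=> [|i].
    rewrite lexx /=; case: p {consec dE} d inc dinc le_p1 => [|[|//]] d inc _ _.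
      by rewrite subr0.
    by have := inc 0%N 1%N isT isT; lia.
  rewrite dE; case: eqP => [-> // | nz_i].
  have := ltn_ord i => lt_ip; rewrite ifF; last by lia.
  by rewrite subrK; congr (d (inord _)); lia.
have run i : (i.+1 < p)%N -> d (inord i.+1) = d (inord 1) + i%:Z.
  elim: i => [|i IHi] lt_ip; first by rewrite addr0.
  by rewrite consec // IHi; lia.
exists (d (inord 0)), (d (inord 1) - 1), (d (inord p) - p%:Z); split=> [|i].
  (* The bound j <= c holds because d_p exceeds d_(p-1) = d_1 + p - 2. *)
  have := inc 0%N 1%N isT (ltnW gt_p1).
  have := inc p.-1 p; have := run p.-2; have -> : p.-2.+1 = p.-1 by lia.
  lia.
rewrite dE; case: eqP => [-> // | nz_i].
case: ltnP => [lt_ip | ge_ip].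
  have := run i.-1; have -> : i.-1.+1 = i :> nat by lia.
  by move/(_ lt_ip); lia.
rewrite subrK; congr (d (inord _)).
by have := ltn_ord i; lia.
Qed.

(** Induction on a strict upper bound [N] for the spread d_(p-1) - d_1. *)
Lemma pi_diagram_compressible (p : nat) (d : 'I_p.+1 -> int) :
  increasing_seq d -> compressible p (pi_diagram p d).
Proof.
have [N] : exists N : nat, d (inord p.-1) - d (inord 1) < N%:Z.
  by exists (`|d (inord p.-1) - d (inord 1)|.+1)%N; lia.
elim: N d => [|N IHN] d ltN dinc.
  (* An index [i] to be checked forces p >= 3, where the spread is positive. *)
  apply/compressible_extremely/extremely_compressed_typeP => // i i_gt0 lt_ip.
  suff : d (inord 1) < d (inord p.-1) by lia.
  by apply: dinc; rewrite !inordK; lia.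
have [/forallP consec | ] := boolP [forall i : 'I_p.+1,
    (0 < i)%N && (i.+1 < p)%N ==> (d (inord i.+1) == d i + 1)].
  apply/compressible_extremely/extremely_compressed_typeP => // i i_gt0 lt_ip.
  have := consec (inord i); rewrite inordK; last by lia.
  by rewrite i_gt0 lt_ip => /eqP.
rewrite negb_forall => /existsP[i]; rewrite negb_imply.
case/andP=> /andP[i_gt0 lt_ip] gap.
have inc k l : (k < l)%N -> (l <= p)%N -> d (inord k) < d (inord l).
  by move=> lt_kl le_lp; apply: dinc; rewrite !inordK //; lia.
have di : d i = d (inord i) by rewrite inord_val.
(* Since d_(i+1) differs from d_i + 1, this integer is missing from [d]; [en] inserts it at index
   [i + 1]. *)
pose m := d i + 1.
have m_lt : m < d (inord i.+1).
  by have := inc i i.+1 (ltnSn _); move: gap; rewrite /m di; lia.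
pose en (k : nat) : int :=
  if (k <= i)%N then d (inord k) else if k == i.+1 then m else d (inord k.-1).
pose e (k : 'I_p.+2) : int := en k.
have einc : increasing_seq e.
  move=> k l lt_kl; have := ltn_ord l; rewrite ltnS => le_lp; rewrite /e /en.
  have le_d j l' : (j <= l')%N -> (l' <= p)%N -> d (inord j) <= d (inord l').
    by rewrite leq_eqVlt => /predU1P[-> // | lt_j ?]; apply/ltW/inc.
  case: (leqP k i) => [le_ki | lt_ik]; case: (leqP l i) => [le_li | lt_il].
  - by apply: inc => //; lia.
  - case: eqP => [_ | neq_l]; last by apply: inc; lia.
    by have := le_d k i le_ki; rewrite /m di; lia.
  - lia.
  rewrite (_ : (l == i.+1 :> nat) = false); last by lia.
  case: eqP => [_ | neq_k]; last by apply: inc; lia.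
  by apply: lt_le_trans m_lt (le_d _ _ _ _); lia.
have eE (z k : nat) : (z <= p.+1)%N -> (k <= p)%N ->
    e (lift (inord z) (inord k : 'I_p.+1)) = en (bump z k).
  by move=> le_z le_k; rewrite /e /= !inordK //; lia.
have ed : (fun k => e (lift (inord i.+1) k)) =1 d.
  move=> k; have le_kp : (k <= p)%N by rewrite -ltnS.
  rewrite -[in LHS](inord_val k) eE //.
  rewrite -[in RHS](inord_val k) /en /bump.
  case: (leqP i.+1 k) => [lt_ik | le_ki] /=; last by rewrite ifT.
  by rewrite add1n add0n ltnNge (ltnW lt_ik) eqSS gtn_eqF.
apply: (eq_compressible p _ _ (eq_pi_diagram p _ _ ed)).
have en1 : en 1 = d (inord 1) by rewrite /en i_gt0.
have enp : en p = d (inord p.-1).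
  rewrite /en ifF; last by lia.
  by case: eqP => // ?; lia.
have einc_n k l : (k < l)%N -> (l <= p.+1)%N -> en k < en l.
  move=> lt_kl le_l.
  by have := einc (inord k) (inord l); rewrite /e !inordK //; lia.
(* In [e] the degrees d_1 and d_(p-1) have indices 1 and [p], the latter moved up by the
   insertion. *)
apply: (compressible_exchange p e (inord 1) (inord i.+1) (inord p)) => //.
- by rewrite !inordK //; lia.
- by rewrite !inordK //; lia.
(* Without d_1 the lower end of the middle run rises; in the other case, without d_(p-1), the upper
   end falls. *)
- apply: IHN; last exact: increasing_seq_lift.
  rewrite !eE; try lia.
  have -> : bump 1 p.-1 = p by rewrite /bump; lia.
  have : en 1%N < en (bump 1 1) by apply: einc_n => //; rewrite /bump; lia.
  by rewrite enp en1; lia.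
apply: IHN; last exact: increasing_seq_lift.
rewrite !eE; try lia.
have -> : bump p p.-1 = p.-1 by rewrite /bump; lia.
have -> : bump p 1 = 1%N by rewrite /bump; lia.
have : en p.-1 < en p by apply: einc_n; lia.
by rewrite enp en1; lia.
Qed.

(** * Cancellation sums and non-negative combinations *)

Lemma cancel_diagramE (k l i j : int) :
  cancel_diagram (k, l) (i, j) =
  ((i, j) == (k, l))%:R + ((i - 1, j) == (k, l))%:R.
Proof.
rewrite fsfunE in_fset2 !xpair_eqE subr_eq /=.
have : (i == k) && (i == k + 1) = false by lia.
move: (i == k) (i == k + 1) (j == l).
by do 3!case; rewrite //= ?addr0 ?add0r.
Qed.

(** Only the cancellation diagrams at (i, j) and (i - 1, j) meet the position (i, j). *)
Lemma sum_cancel_diagram (b : ratmx_fin) (i j : int) :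
  \sum_(kl <- finsupp b) b kl * cancel_diagram kl (i, j) =
  b (i, j) + b (i - 1, j).
Proof.
have pick x : \sum_(kl <- finsupp b) b kl * (x == kl)%:R = b x.
  have [bx | nbx] := boolP (x \in finsupp b).
    rewrite (bigD1_seq x) ?fset_uniq //= eqxx mulr1 big1 ?addr0 // => y.
    by rewrite eq_sym => /negPf ->; rewrite mulr0.
  rewrite (fsfun_dflt nbx) big_seq big1 // => y by_.
  by case: eqP => [xy | _]; rewrite ?mulr0 //; move: nbx; rewrite xy by_.
rewrite -!pick -big_split; apply: eq_bigr => -[k l] _ /=.
by rewrite cancel_diagramE mulrDr.
Qed.

(** Uniqueness identifies any pure diagram with the explicit one of the same type. *)
Lemma pure_diagram_compressible (p : nat) (P : ratmx_fin) :
  pure_diagram p P -> compressible p P /\ forall x, 0 <= P x.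
Proof.
case=> d [dinc piP].
have PE := is_pi_unique p d _ _ dinc (pi_diagram_is_pi p d dinc) piP.
split=> [|x]; first exact: eq_compressible PE (pi_diagram_compressible p d dinc).
rewrite -PE delta_sumE sumr_ge0 // => i _.
by rewrite mulrn_wge0 // pi_entry_ge0.
Qed.

Lemma compressible_sum (p n : nat) (a : 'I_n -> rat) (P : 'I_n -> ratmx_fin) :
  (forall k, 0 <= a k) -> (forall k, compressible p (P k)) ->
  compressible p (fun x => \sum_k a k * P k x).
Proof.
have compressible0 : compressible p (fun=> 0).
  exists [fsfun], [fsfun]; split=> [|x|i j _|i j]; rewrite ?fsfun0E //.
  by apply: nonneg_combination0 => x; rewrite fsfun0E.
elim: n a P => [|n IHn] a P a_ge0 CP.
  by apply: eq_compressible compressible0 => x; rewrite big_ord0.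
have CS := IHn (fun k => a (lift ord0 k)) (fun k => P (lift ord0 k))
  (fun k => a_ge0 _) (fun k => CP _).
apply: (compressible_lin p (a ord0) 1 _ _ _ [fsfun] _ _ (CP ord0) CS) => //.
- by move=> x; rewrite fsfun0E.
- by move=> i j _; rewrite fsfun0E.
by move=> i j; rewrite !fsfun0E addr0 mul1r big_ord_recl.
Qed.

Theorem proposition4p3 (p : nat) (D : ratmx_fin)
  (hD : nonneg_combination (pure_diagram p) D) :
  exists E : ratmx_fin,
    [/\ is_diagram p E,
        nonneg_combination (extremely_compressed p) E,
        obtained_by_cancellations D E,
        forall j : int, E (0, j) = D (0, j)
      & forall j : int, E (p%:Z, j) = D (p%:Z, j)].
Proof.
have [n [a [P [a_ge0 PP DE]]]] := hD.
have [E [b [CE b_ge0 b_supp sumE]]] := compressible_sum p n a P a_ge0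
  (fun k => (pure_diagram_compressible p _ (PP k)).1).
exists E; split=> //.
- apply: nonneg_combination_is_diagram CE.
  by move=> Q [d [_ _ []]].
- exists b; split=> // i j; last by rewrite sum_cancel_diagram DE sumE.
  rewrite DE sumr_ge0 // => k _; rewrite mulr_ge0 //.
  exact: (pure_diagram_compressible p _ (PP k)).2.
(* Row 0 involves [b] in rows 0 and -1, row [p] involves it in rows [p] and [p - 1]; all of them lie
   outside the range from 1 to [p - 2]. *)
- by move=> j; rewrite DE sumE !b_supp ?addr0 ?subr0.
move=> j; rewrite DE sumE !b_supp ?addr0 ?subr0 //; lia.
Qed.
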